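(* Let $d\ge 1$ and $K\ge 2$ be integers. There exists a constant $C(d,K)>0$ depending only on $d$ and $K$ such that for every integer $n\ge 1$ and every analytic polynomial $f:\mathbf{T}^n\to\mathbf{C}$ of degree at most $d$ and individual degree at most $K-1$, $$\|f\|_{\mathbf{T}^n}\le C(d,K)\,\|f\|_{\Omega_K^n}.$$
   Context: $\mathbf{T}=\{z\in\mathbf{C}:|z|=1\}$. For an integer $K\ge 1$, $\Omega_K=\{1,\omega_K,\dots,\omega_K^{K-1}\}\subset\mathbf{T}$ is the multiplicative cyclic group of $K$-th roots of unity, with $\omega_K=e^{2\pi i/K}$. An analytic polynomial of (total) degree at most $d$ and individual degree at most $K-1$ is a function $f(z)=\sum_{\alpha\in\{0,1,\dots,K-1\}^n,\ |\alpha|\le d}\widehat f(\alpha)z^\alpha$ with coefficients $\widehat f(\alpha)\in\mathbf{C}$, where $|\alpha|=\sum_j\alpha_j$ and $z^\alpha=\prod_j z_j^{\alpha_j}$. For a set $X$, $\|f\|_X:=\sup_{x\in X}|f(x)|$. *)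

(* Defs.v *)
From HB Require Import structures.
From mathcomp Require Import all_boot all_order all_algebra.
From mathcomp Require Import all_classical all_reals all_analysis.
From mathcomp Require Export complex.

Set Implicit Arguments.
Unset Strict Implicit.
Unset Printing Implicit Defensive.

Import Order.TTheory GRing.Theory Num.Theory.
Import ComplexField.

Local Open Scope classical_set_scope.
Local Open Scope ring_scope.
Local Open Scope complex_scope.

Definition circle (R : realType) : set R[i] := [set z | Normc.normc z = 1].

Arguments circle R : clear implicits.

Definition omega (R : realType) (K : nat) : R[i] :=
  cos (2 * pi / K%:R) +i* sin (2 * pi / K%:R).

Definition roots_of_unity (R : realType) (K : nat) : set R[i] :=
  [set omega R K ^+ k | k in [set k | (k < K)%N]].

Arguments roots_of_unity R K : clear implicits.

Definition cartesian_power (T : Type) (X : set T) (n : nat) : set ('I_n -> T) :=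
  [set z | forall j, X (z j)].

Arguments cartesian_power {T} X n.

(* Multi-indices in {0, ..., K-1}^n are the finite functions 'I_n -> 'I_K.
   Only the values of f on the torus are constrained: f stands for a function
   defined on the torus, and its values elsewhere are irrelevant. *)
Definition analytic_polynomial (R : realType) (d K n : nat)
    (f : ('I_n -> R[i]) -> R[i]) : Prop :=
  exists fhat : {ffun 'I_n -> 'I_K} -> R[i],
    forall z, cartesian_power (circle R) n z ->
      f z = \sum_(alpha : {ffun 'I_n -> 'I_K} | (\sum_j alpha j <= d)%N)
              fhat alpha * \prod_j z j ^+ alpha j.

(* The supremum is taken in the extended reals, so that no boundedness side
   condition is needed for it to be the actual supremum. *)
Definition supnorm (R : realType) (T : Type) (X : set T) (f : T -> R[i]) :
    \bar R :=
  ereal_sup [set (Normc.normc (f x))%:E | x in X].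

(* Main.v *)
(** Interpolation at the K-th roots of unity writes the point evaluation at [z]
    as a complex measure [c_x(z)] of total mass 1 on [Omega_K] (in each variable),
    valid for degree at most K-1.  Its affine perturbation of the uniform measure
      [1/K - t^2 (Re c_x - 1/K) + t Im c_x]
    is a probability measure for small real [t >= 0] and equals [c_x] at [t = i].
    Averaging [f] over the product of these measures gives a polynomial in [t]
    whose degree is at most 2d, independently of [n], because the factors
    belonging to variables absent from a monomial sum to 1.  It is bounded by
    the supremum over [Omega_K^n] for small [t >= 0], so Lagrange interpolation
    at 2d+1 such nodes bounds its value at [t = i], which is [f(z)]. *)

Require Import Defs.
From mathcomp Require Import all_boot all_order all_algebra.
From mathcomp Require Import all_classical all_reals all_analysis.
From mathcomp Require Import ring lra.

Set Implicit Arguments.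
Unset Strict Implicit.
Unset Printing Implicit Defensive.

Import Order.TTheory GRing.Theory Num.Theory.
Import ComplexField.

Local Open Scope ring_scope.
Local Open Scope complex_scope.

(** * Univariate polynomials: interpolation and degree *)

(** The constant sums the absolute values at [y] of the Lagrange basis polynomials, so it does not
    depend on [p]; the added 1 makes it positive. *)
Lemma lagrange_norm_bound (F : numFieldType) (x : nat -> F) (n : nat) (y : F) :
  (0 < n)%N -> injective x ->
  exists2 C : F, 0 < C &
    forall (p : {poly F}) (M : F), (size p <= n)%N ->
      (forall i, `|p.[x i]| <= M) -> `|p.[y]| <= C * M.
Proof.
move=> n_gt0 x_inj.
exists (1 + \sum_(i < n) `|(tnth (lagrange n x) i : {poly F}).[y]|).
  by rewrite ltr_pwDl // sumr_ge0.
move=> p M sp pM; have M_ge0 : 0 <= M := le_trans (normr_ge0 _) (pM 0).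
rewrite {1}(lagrange_gen n_gt0 x_inj sp) horner_sum mulrDl mul1r.
apply: le_trans (ler_norm_sum _ _ _) _.
rewrite ler_wpDl // mulr_suml; apply: ler_sum => i _.
by rewrite hornerM hornerC normrM mulrC ler_wpM2l.
Qed.

Lemma size_prod_leS (F : nzRingType) (n : nat) (G : 'I_n -> {poly F})
    (m : 'I_n -> nat) :
  (forall j, (size (G j) <= (m j).+1)%N) ->
  (size (\prod_j G j)%R <= (\sum_j m j).+1)%N.
Proof.
elim: n G m => [|n IHn] G m Gm; first by rewrite !big_ord0 size_poly1.
rewrite !big_ord_recl; apply: leq_trans (size_polyMleq _ _) _.
have := leq_add (Gm ord0) (IHn _ _ (fun j => Gm (lift ord0 j))).
by rewrite addSn addnS; case: (_ + _)%N.
Qed.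

(** Stated over any commutative ring, to serve over [{poly R[i]}] as well as over [R[i]]. *)
Definition multipoly (A : comNzRingType) (d K n : nat)
    (fhat : {ffun 'I_n -> 'I_K} -> A) (z : 'I_n -> A) : A :=
  \sum_(alpha : {ffun 'I_n -> 'I_K} | (\sum_j alpha j <= d)%N)
    fhat alpha * \prod_j z j ^+ alpha j.

(** A product measure integrates a monomial one variable at a time: distributivity turns the sum
    over [s] into a product of sums. *)
Lemma sum_multipoly_prod (A : comNzRingType) (d K n : nat)
    (fhat : {ffun 'I_n -> 'I_K} -> A) (y : 'I_K -> A) (c : 'I_n -> 'I_K -> A) :
  \sum_(s : {ffun 'I_n -> 'I_K})
      multipoly d fhat (fun j => y (s j)) * \prod_j c j (s j)
  = \sum_(alpha : {ffun 'I_n -> 'I_K} | (\sum_j alpha j <= d)%N)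
      fhat alpha * \prod_j \sum_x y x ^+ alpha j * c j x.
Proof.
rewrite /multipoly.
under eq_bigr do rewrite mulr_suml.
rewrite exchange_big; apply: eq_bigr => alpha _.
rewrite (bigA_distr_bigA (fun j x => y x ^+ alpha j * c j x)) mulr_sumr.
by apply: eq_bigr => s _; rewrite -mulrA -big_split.
Qed.

(** * Interpolation at the roots of unity *)

Lemma primitive_root_omega (R : realType) (K : nat) :
  (0 < K)%N -> K.-primitive_root (omega R K).
Proof.
move=> K_gt0.
have K0 : (K%:R : R) != 0 by rewrite pnatr_eq0 -lt0n.
have omegaX k : omega R K ^+ k =
    cos ((pi * k%:R / K%:R) *+ 2) +i* sin ((pi * k%:R / K%:R) *+ 2).
  elim: k => [|k IHk]; first by rewrite expr0 mulr0 mul0r mul0rn cos0 sin0.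
  rewrite exprSr IHk /omega.
  have -> : (pi * k.+1%:R / K%:R) *+ 2
      = (pi * k%:R / K%:R) *+ 2 + 2 * pi / K%:R :> R.
    by rewrite -natr1; field.
  set a := _ *+ 2; set b := 2 * pi / _.
  by rewrite (cosD a b) (sinD a b) (addrC (sin a * _)).
have omegaK : omega R K ^+ K = 1 by rewrite omegaX mulfK // cos2pi sin2pi.
have [m mprim /(dvdn_leq K_gt0)] := prim_order_exists K_gt0 omegaK.
rewrite leq_eqVlt => /predU1P[mK|m_lt_K]; first by rewrite -{1}mK.
exfalso.
have m_gt0 := prim_order_gt0 mprim.
have /eqP := prim_expr_order mprim; rewrite omegaX eq_complex /= => /andP[].
set x := pi * _ / _ => /eqP + _.
(* As the order [m] is below [K], 0 < [x] < pi, so cos(2x) = 1 - 2 sin(x)^2 is less than 1. *)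
have : 0 < sin x.
  apply: sin_gt0_pi; rewrite /x divr_gt0 ?mulr_gt0 ?pi_gt0 ?ltr0n //=.
  by rewrite ltr_pdivrMr ?ltr0n // ltr_pM2l ?pi_gt0 // ltr_nat.
by rewrite cos_mulr2n cos2sin2; nra.
Qed.

(** For a primitive [K]-th root [w], this is the Lagrange basis polynomial of the node [w ^+ x]
    among the [K]-th roots of unity, evaluated at [z]. *)
Definition root_kernel (F : fieldType) (K : nat) (w z : F) (x : nat) : F :=
  K%:R^-1 * \sum_(l < K) z ^+ l * (w ^+ x) ^- l.

(** Orthogonality of characters: exchanging the sums leaves, for each [l], a geometric sum of ratio
    [w ^+ m / w ^+ l], equal to [K] if [l = m] and to 0 otherwise. *)
Lemma root_kernel_reproducing (F : fieldType) (K : nat) (w z : F) (m : nat) :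
  K%:R != 0 :> F -> K.-primitive_root w -> (m < K)%N ->
  \sum_(x < K) (w ^+ x) ^+ m * root_kernel K w z x = z ^+ m.
Proof.
move=> K0 wprim mK.
have w0 : w != 0.
  have /eqP := prim_expr_order wprim; apply: contraTneq => ->.
  by rewrite expr0n gtn_eqF ?(prim_order_gt0 wprim) // eq_sym oner_eq0.
under eq_bigr do rewrite mulrCA mulr_sumr.
rewrite -mulr_sumr exchange_big /=.
have sumE (l : 'I_K) : \sum_(x < K) (w ^+ x) ^+ m * (z ^+ l * (w ^+ x) ^- l)
    = if l == Ordinal mK then z ^+ m * K%:R else 0.
  transitivity (z ^+ l * \sum_(x < K) (w ^+ m / w ^+ l) ^+ x).
    rewrite mulr_sumr; apply: eq_bigr => x _.
    by rewrite mulrCA expr_div_n -!exprM !(mulnC x).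
  case: eqVneq => [->|lm] /=.
    rewrite divff ?expf_neq0 //.
    by under eq_bigr do rewrite expr1n; rewrite sumr_const card_ord.
  have q1 : w ^+ m / w ^+ l - 1 != 0.
    apply: contraNneq lm => /eqP; rewrite subr_eq0 => /eqP q1.
    have /eqP : w ^+ m = w ^+ l by rewrite -[RHS]mul1r -q1 divfK ?expf_neq0.
    by rewrite (eq_prim_root_expr wprim) !modn_small // eq_sym.
  have := subrX1 (w ^+ m / w ^+ l) K.
  rewrite expr_div_n -!exprM ![(_ * K)%N]mulnC !exprM (prim_expr_order wprim).
  rewrite !expr1n divr1 subrr => /esym/eqP; rewrite mulf_eq0 (negPf q1) /=.
  by move=> /eqP->; rewrite mulr0.
under eq_bigr do rewrite sumE.
by rewrite -big_mkcond big_pred1_eq mulrCA mulVf ?mulr1.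
Qed.

Lemma root_kernel_norm_le1 (F : numFieldType) (K : nat) (w z : F) (x : nat) :
  (0 < K)%N -> `|w| = 1 -> `|z| = 1 -> `|root_kernel K w z x| <= 1.
Proof.
move=> K_gt0 w1 z1; rewrite normrM normfV normr_nat.
rewrite mulrC ler_pdivrMr ?ltr0n // mul1r.
apply: le_trans (ler_norm_sum _ _ _) _.
under eq_bigr do rewrite normrM normfV !normrX w1 z1 !expr1n invr1 mulr1.
by rewrite sumr_const card_ord.
Qed.

Lemma normr_normc (R : rcfType) (x : R[i]) : `|x| = (Normc.normc x)%:C.
Proof. by []. Qed.

(* The square in [t] makes the coefficient of the real part real at [t = i]. *)
Definition weight (R : realType) (K : nat) (z : R[i]) (x : nat) : {poly R[i]} :=
  let c := root_kernel K (omega R K) z x in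
  (K%:R^-1)%:P - (complex.Re c - K%:R^-1)%:C *: 'X^2 + (complex.Im c)%:C *: 'X.

(** * Perturbed uniform weights *)

Section Weight.
Variables (R : realType) (K : nat).
Hypothesis K_gt0 : (0 < K)%N.

Let K0 : K%:R != 0 :> R[i]. Proof. by rewrite pnatr_eq0 -lt0n. Qed.

Lemma normr_omega : `|omega R K| = 1.
Proof. by rewrite normc_def /= cos2Dsin2 sqrtr1. Qed.

Lemma size_weight (z : R[i]) x : (size (weight K z x) <= 3)%N.
Proof.
rewrite /weight; set c := root_kernel _ _ _ _.
rewrite (leq_trans (size_polyD _ _)) // geq_max.
rewrite (leq_trans (size_polyD _ _)) ?geq_max ?size_polyN.
  by rewrite (leq_trans (size_scale_leq _ _)) // size_polyX.
rewrite (leq_trans (size_polyC_leq1 _)) // (leq_trans (size_scale_leq _ _)) //.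
by rewrite size_polyXn.
Qed.

Lemma horner_weight_i (z : R[i]) x :
  (weight K z x).['i%C] = root_kernel K (omega R K) z x.
Proof.
rewrite /weight; set c := root_kernel _ _ _ _.
rewrite 2!hornerD hornerN !hornerZ hornerXn hornerX hornerC sqr_i.
by rewrite [RHS]complexE rmorphB /= fmorphV rmorph_nat; ring.
Qed.

Lemma sum_weight (z : R[i]) : \sum_(x < K) weight K z x = 1.
Proof.
have prim := primitive_root_omega R K_gt0.
have sum_kernel : \sum_(x < K) root_kernel K (omega R K) z x = 1.
  rewrite -(expr0 z) -(root_kernel_reproducing z K0 prim K_gt0).
  by apply: eq_bigr => x _; rewrite expr0 mul1r.
(* Real and imaginary parts are only real-linear, hence the view of their domain as [Rcomplex R]. *)
have sumRe : \sum_(x < K) complex.Re (root_kernel K (omega R K) z x) = 1.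
  have := congr1 (@complex.Re R : Rcomplex R -> R) sum_kernel.
  by rewrite (raddf_sum (@complex.Re R : Rcomplex R -> R)).
have sumIm : \sum_(x < K) complex.Im (root_kernel K (omega R K) z x) = 0.
  have := congr1 (@complex.Im R : Rcomplex R -> R) sum_kernel.
  by rewrite (raddf_sum (@complex.Im R : Rcomplex R -> R)).
have sumV (F : fieldType) : K%:R != 0 :> F -> \sum_(x < K) K%:R^-1 = 1 :> F.
  by move=> ?; rewrite sumr_const card_ord -[_ *+ K]mulr_natr mulVf.
rewrite /weight big_split /= big_split /= sumrN -!scaler_suml -!rmorph_sum /=.
rewrite sumIm sumrB sumRe !sumV ?subrr ?rmorph0 ?rmorph1 ?scale0r ?subr0 ?addr0 //.
by rewrite pnatr_eq0 -lt0n.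
Qed.

(** Each of the two perturbations lowers the value 1/K by at most [t], and 2t <= 2/(3K). *)
Lemma weight_ge0 (z : R[i]) x (t : R) :
  `|z| = 1 -> 0 <= t -> t <= (3 * K%:R)^-1 -> 0 <= (weight K z x).[t%:C].
Proof.
move=> z1 t0 t3.
rewrite /weight; set c := root_kernel _ _ _ _.
have c1 : `|c| <= 1 by apply: root_kernel_norm_le1; rewrite // normr_omega.
have Rec : `|complex.Re c| <= 1.
  by rewrite -lecR (le_trans (normc_ge_Re _)).
have Imc : `|complex.Im c| <= 1.
  (* The imaginary part of [c] is minus the real part of [c * 'i]. *)
  rewrite -lecR -[complex.Im c]opprK -ReiNIm normrN (le_trans (normc_ge_Re _)) //.
  by rewrite normrM (normc_def 'i%C) /= expr0n expr1n add0r sqrtr1 mulr1.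
have -> : ((K%:R^-1)%:P - (complex.Re c - K%:R^-1)%:C *: 'X^2
           + (complex.Im c)%:C *: 'X).[t%:C]
    = (K%:R^-1 - (complex.Re c - K%:R^-1) * t ^+ 2 + complex.Im c * t)%:C.
  rewrite 2!hornerD hornerN !hornerZ hornerXn hornerX hornerC.
  by rewrite !(rmorphD, rmorphN, rmorphM, rmorphXn) /= fmorphV rmorph_nat.
rewrite ler0c; move: Rec Imc t3; rewrite !ler_norml invfM.
have Kle1 : K%:R^-1 <= 1 :> R by rewrite invf_le1 ?ltr0n // ler1n.
have Kgt0 : 0 < K%:R^-1 :> R by rewrite invr_gt0 ltr0n.
set k := K%:R^-1 in Kle1 Kgt0 *; move=> /andP[_ r1] /andP[i1 _] tk.
have : t <= 1 by lra.
nra.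
Qed.

End Weight.

Definition mixture (R : realType) (d K n : nat)
    (fhat : {ffun 'I_n -> 'I_K} -> R[i]) (z : 'I_n -> R[i]) : {poly R[i]} :=
  \sum_(s : {ffun 'I_n -> 'I_K})
    (multipoly d fhat (fun j => omega R K ^+ s j))%:P
    * \prod_j weight K (z j) (s j).

(** * Averages against product weights *)

Section Mixture.
Variables (R : realType) (d K n : nat).
Variables (fhat : {ffun 'I_n -> 'I_K} -> R[i]) (z : 'I_n -> R[i]).
Hypothesis K_gt0 : (0 < K)%N.

Lemma horner_mixture t : (mixture d fhat z).[t] =
  \sum_(s : {ffun 'I_n -> 'I_K})
    multipoly d fhat (fun j => omega R K ^+ s j)
    * \prod_j (weight K (z j) (s j)).[t].
Proof.
rewrite horner_sum; apply: eq_bigr => s _.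
by rewrite hornerM hornerC horner_prod.
Qed.

Lemma size_mixture : (size (mixture d fhat z) <= (2 * d).+1)%N.
Proof.
(* The constants move inside the polynomial ring, so that the factorization applies over [{poly
   R[i]}]. *)
have -> : mixture d fhat z =
    \sum_(s : {ffun 'I_n -> 'I_K})
      multipoly d (fun alpha => (fhat alpha)%:P)
        (fun j => (omega R K ^+ s j)%:P) * \prod_j weight K (z j) (s j).
  apply: eq_bigr => s _; congr (_ * _); rewrite rmorph_sum /=.
  apply: eq_bigr => alpha _; rewrite rmorphM rmorph_prod /=.
  by congr (_ * _); apply: eq_bigr => j _; rewrite rmorphXn.
rewrite (sum_multipoly_prod _ _ (fun x : 'I_K => (omega R K ^+ x)%:P)
  (fun j (x : 'I_K) => weight K (z j) x)).
apply: leq_trans (size_sum _ _ _) _; apply/bigmax_leqP => alpha alpha_d.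
rewrite mul_polyC (leq_trans (size_scale_leq _ _)) //.
apply: leq_trans (size_prod_leS (m := fun j => (2 * alpha j)%N) _) _; last first.
  by rewrite -big_distrr /= ltnS leq_mul2l.
(* An absent variable contributes exactly 1, which keeps the degree free of [n]; a present one
   contributes degree at most 2, hence at most [2 * alpha j]. *)
move=> j; case: (nat_of_ord (alpha j)) => [|k].
  under eq_bigr do rewrite expr0 mul1r.
  by rewrite sum_weight // size_poly1.
apply: leq_trans (size_sum _ _ _) _; apply/bigmax_leqP => x _.
rewrite -rmorphXn mul_polyC (leq_trans (size_scale_leq _ _)) //.
by rewrite (leq_trans (size_weight _ _ _)) // mulnS.
Qed.

(** Interpolation is exact on each power [z j ^+ alpha j] because [alpha j < K]. *)
Lemma mixture_i : (mixture d fhat z).['i%C] = multipoly d fhat z.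
Proof.
rewrite horner_mixture.
rewrite (sum_multipoly_prod d fhat (fun x : 'I_K => omega R K ^+ x)
  (fun j (x : 'I_K) => (weight K (z j) x).['i%C])).
apply: eq_bigr => alpha _; congr (_ * _); apply: eq_bigr => j _.
under eq_bigr do rewrite horner_weight_i.
apply: root_kernel_reproducing; rewrite ?pnatr_eq0 -?lt0n //.
exact: primitive_root_omega.
Qed.

Lemma normr_mixture_le (M : R[i]) (t : R) :
  (forall j, `|z j| = 1) -> 0 <= t -> t <= (3 * K%:R)^-1 ->
  (forall s : {ffun 'I_n -> 'I_K},
    `|multipoly d fhat (fun j => omega R K ^+ s j)| <= M) ->
  `|(mixture d fhat z).[t%:C]| <= M.
Proof.
move=> z1 t0 t3 fM; rewrite horner_mixture.
have w_ge0 j x : 0 <= (weight K (z j) x).[t%:C] by apply: weight_ge0.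
apply: le_trans (ler_norm_sum _ _ _) _.
(* The product weights have total mass 1, so [M] is its own average. *)
have -> : M = \sum_(s : {ffun 'I_n -> 'I_K})
    M * \prod_j (weight K (z j) (s j)).[t%:C].
  rewrite -mulr_sumr.
  rewrite -(bigA_distr_bigA (fun j (x : 'I_K) => (weight K (z j) x).[t%:C])) /=.
  under eq_bigr do rewrite -horner_sum sum_weight // hornerC.
  by rewrite big1 ?mulr1.
apply: ler_sum => s _.
by rewrite normrM [`|\prod_j _|]ger0_norm ?ler_wpM2r ?prodr_ge0.
Qed.

End Mixture.

(** * The dimension-free bound *)

Lemma multipoly_bound (R : realType) (d K : nat) : (0 < K)%N ->
  exists2 C : R, 0 < C &
    forall (n : nat) (fhat : {ffun 'I_n -> 'I_K} -> R[i]) (M : R),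
      (forall s : {ffun 'I_n -> 'I_K},
        Normc.normc (multipoly d fhat (fun j => omega R K ^+ s j)) <= M) ->
      forall z : 'I_n -> R[i], (forall j, Normc.normc (z j) = 1) ->
        Normc.normc (multipoly d fhat z) <= C * M.
Proof.
move=> K_gt0.
(* Distinct points of (0, 1/(3K)], chosen before [n] and [z], so that the interpolation constant
   depends only on [d] and [K]. *)
pose node k : R := (3 * K%:R * k.+1%:R)^-1.
have node_inj : injective (fun k => (node k)%:C).
  move=> k l /complexI /invr_inj /mulfI.
  rewrite mulf_neq0 ?pnatr_eq0 -?lt0n // => /(_ isT)/eqP.
  by rewrite eqr_nat => /eqP[].
have [C C_gt0 boundC] := lagrange_norm_bound 'i%C (ltn0Sn (2 * d)) node_inj.
(* A positive element of [R[i]] is real. *)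
have CE : C = (complex.Re C)%:C by rewrite RRe_real ?gtr0_real.
exists (complex.Re C) => [|n fhat M fM z z1]; first by rewrite -ltcR -CE.
rewrite -lecR rmorphM /= -CE -normr_normc -mixture_i //.
apply: boundC => [|k]; first exact: size_mixture.
apply: normr_mixture_le => // [j| | |s].
- by rewrite normr_normc z1.
- by rewrite invr_ge0 !mulr_ge0.
- rewrite /node invfM ler_piMr ?invr_ge0 ?mulr_ge0 //.
  by rewrite invf_le1 ?ltr0n // ler1n.
- by rewrite normr_normc lecR.
Qed.

Theorem theorem1 (R : realType) (d K : nat) (hd : (1 <= d)%N) (hK : (2 <= K)%N) :
  exists C : R, 0 < C /\
    forall (n : nat) (f : ('I_n -> R[i]) -> R[i]),
      (1 <= n)%N -> analytic_polynomial d K f ->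
      (supnorm (cartesian_power (circle R) n) f <=
       C%:E * supnorm (cartesian_power (roots_of_unity R K) n) f)%E.
Proof.
have K_gt0 : (0 < K)%N by apply: leq_trans hK.
have [C C_gt0 boundC] := multipoly_bound R d K_gt0.
exists C; split=> // n f _ [fhat fE].
(* The formula [fE] for [f] is available only on the torus. *)
have omega_circle k : circle R (omega R K ^+ k).
  by apply: complexI; rewrite -normr_normc normrX normr_omega expr1n.
have le_supnorm (s : {ffun 'I_n -> 'I_K}) :
    ((Normc.normc (multipoly d fhat (fun j => omega R K ^+ s j)))%:E <=
     supnorm (cartesian_power (roots_of_unity R K) n) f)%E.
  apply: ereal_sup_ubound; exists (fun j => omega R K ^+ s j).
    by move=> j; exists (s j); first exact: ltn_ord.
  by rewrite fE.
apply: ge_ereal_sup => _ [z zT <-]; rewrite fE //.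
(* An infinite supremum makes the bound trivial since [C > 0]; the value -oo is excluded by the
   point (1, ..., 1). *)
case: supnorm le_supnorm => [M| |] le_M.
- by rewrite -EFinM lee_fin boundC // => s; rewrite -lee_fin.
- by rewrite gt0_muley ?lte_fin // leey.
- by have := le_M [ffun=> Ordinal K_gt0]; rewrite leeNy_eq.
Qed.
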